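(* Let $\sigma(n)$ denote the minimum integer $m$ such that any $m$ unit vectors in $\mathbb{R}^n$ are selectively balancing. Then $$\sigma(n) \sim \tfrac{1}{2}\, n \log n \qquad (n \to \infty),$$ where $\log$ is the logarithm to base $2$. In other words, for any two constants $c_1 > 1/2 > c_2$, we have $c_1 n \log n > \sigma(n) > c_2 n \log n$ for all sufficiently large $n$.
   Context: The norm $\|\cdot\|$ is the Euclidean norm on $\mathbb{R}^n$, and unit vectors are vectors of Euclidean norm $1$. A set of unit vectors $U = \{\mathbf{u}_1, \dots, \mathbf{u}_m\}$ in $\mathbb{R}^n$ is selectively balancing if there are coefficients $\varepsilon_1,\dots,\varepsilon_m \in \{-1, 0, 1\}$, not all zero, such that $\left\| \sum_{i=1}^m \varepsilon_i \mathbf{u}_i \right\| < 1$ (strict inequality). Equivalently, there are two disjoint subsets $U^+, U^- \subseteq U$, not both empty, such that $\left\| \sum_{\mathbf{u} \in U^+} \mathbf{u} - \sum_{\mathbf{u} \in U^-} \mathbf{u} \right\| < 1$. The base of the logarithm is $2$ throughout. *)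

(* Defs.v *)
From mathcomp Require Import all_boot all_order all_algebra.
From mathcomp Require Import all_classical all_reals all_analysis.

Set Implicit Arguments.
Unset Strict Implicit.
Unset Printing Implicit Defensive.

Import Order.TTheory GRing.Theory Num.Theory.
Import numFieldNormedType.Exports.

Local Open Scope classical_set_scope.
Local Open Scope ring_scope.

(* The library norm `|x| on 'rV[R]_n is the sup norm, not the Euclidean one. *)
Definition enorm (R : realType) (n : nat) (x : 'rV[R]_n) : R :=
  Num.sqrt (\sum_(j < n) x 0 j ^+ 2).

Definition selectively_balancing (R : realType) (n m : nat)
    (u : 'I_m -> 'rV[R]_n) : Prop :=
  exists eps : 'I_m -> R,
    [/\ forall i, eps i \in [:: -1; 0; 1],
        exists i, eps i != 0 &
        enorm (\sum_(i < m) eps i *: u i) < 1].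

(* A set of m unit vectors is given by an injective enumeration u. *)
Definition always_balancing (R : realType) (n m : nat) : Prop :=
  forall u : 'I_m -> 'rV[R]_n,
    injective u -> (forall i, enorm (u i) = 1) -> selectively_balancing u.

(* Pigeonhole: among sufficiently many unit vectors, two lie in a common cell
   of side 1 / (n + 1), hence at distance less than 1. *)
Lemma always_balancing_ex (R : realType) (n : nat) :
  exists m, `[< always_balancing R n m >].
Proof.
pose K := (2 * n.+1).+1.
exists #|{ffun 'I_n -> 'I_K}|.+1; apply/asboolP => u _ u1.
have coord i j : -1 <= u i 0 j <= 1.
  rewrite -ler_norml -(@ler_pXn2r _ 2) ?nnegrE //.
  rewrite real_normK ?num_real // expr1n.
  have sum_ge0 : 0 <= \sum_(k < n) u i 0 k ^+ 2.
    by apply: sumr_ge0 => k _; exact: sqr_ge0.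
  have <- : \sum_(k < n) u i 0 k ^+ 2 = 1.
    by rewrite -[LHS]sqr_sqrtr // -/(enorm (u i)) u1 expr1n.
  by rewrite (bigD1 j) //= lerDl sumr_ge0 // => k _; exact: sqr_ge0.
pose y i j : R := (u i 0 j + 1) * n.+1%:R.
have y_ge0 i j : 0 <= y i j.
  by have /andP[h _] := coord i j; rewrite mulr_ge0 // -lerBlDr sub0r.
have y_trunc i j : ((Num.truncn (y i j))%:R <= y i j < (Num.truncn (y i j)).+1%:R).
  exact: truncn_itv.
have y_lt i j : (Num.truncn (y i j) < K)%N.
  rewrite ltnS -(ler_nat R).
  have /andP[h _] := y_trunc i j; apply: (le_trans h).
  have /andP[_ h'] := coord i j.
  by rewrite natrM ler_wpM2r // -[2]/(1 + 1) lerD2r.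
pose cell i : {ffun 'I_n -> 'I_K} := [ffun j => Ordinal (y_lt i j)].
have /injectivePn[a [b ab cab]] : ~~ injectiveb cell.
  by apply/negP => /injectiveP/leq_card; rewrite card_ord ltnn.
exists (fun i => (i == a)%:R - (i == b)%:R); split.
- move=> i; rewrite !inE; case: (eqVneq i a) => [->|_]; rewrite ?(negbTE ab).
    by rewrite subr0 eqxx !orbT.
  by case: (i == b); rewrite sub0r ?oppr0 eqxx ?orbT.
- by exists a; rewrite eqxx (negbTE ab) subr0 oner_eq0.
have -> : \sum_i ((i == a)%:R - (i == b)%:R) *: u i = u a - u b.
  have ba : b != a by rewrite eq_sym.
  rewrite (bigD1 a) //= (bigD1 b) //= !eqxx (negbTE ab) (negbTE ba).
  rewrite subr0 sub0r scale1r scaleN1r big1 ?addr0 // => i.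
  by case/andP => /negbTE-> /negbTE->; rewrite subr0 scale0r.
have dist j : ((u a - u b) 0 j * n.+1%:R) ^+ 2 <= 1.
  have tab : Num.truncn (y a j) = Num.truncn (y b j).
    by move/ffunP/(_ j): cab; rewrite !ffunE => -[].
  have -> : (u a - u b) 0 j * n.+1%:R = y a j - y b j.
    by rewrite !mxE /y -mulrBl opprD addrACA subrr addr0.
  rewrite -real_normK ?num_real // expr_le1 // ler_norml.
  have := y_trunc a j; have := y_trunc b j; rewrite tab -natr1.
  move=> /andP[b1 b2] /andP[a1 a2]; apply/andP; split.
    by rewrite lerBrDr addrC lerBlDr (le_trans (ltW b2)) // lerD2r.
  by rewrite lerBlDr addrC (le_trans (ltW a2)) // lerD2r.
rewrite /enorm -[ltRHS]sqrtr1 ltr_sqrt //.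
have n1 : 0 < n.+1%:R ^+ 2 :> R by rewrite exprn_gt0.
rewrite -(ltr_pM2r n1) mul1r mulr_suml.
apply: (@le_lt_trans _ _ (\sum_(j < n) 1)).
  by apply: ler_sum => j _; rewrite -exprMn.
rewrite sumr_const card_ord -natrX ltr_nat.
by rewrite (leq_trans (ltnSn n)) // leq_pmulr.
Qed.

Definition sigma (R : realType) (n : nat) : nat :=
  ex_minn (always_balancing_ex R n).

Definition log2 (R : realType) (x : R) : R := ln x / ln 2.

(* Main.v *)
Require Import Defs.
From mathcomp Require Import all_boot all_order all_algebra.
From mathcomp Require Import all_classical all_reals all_analysis.
From mathcomp Require Import ring lra zify.

Import Order.TTheory GRing.Theory Num.Theory.
Import numFieldNormedType.Exports.

Local Open Scope classical_set_scope.
Local Open Scope ring_scope.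

(** Upper bound.  If m unit vectors are not selectively balancing, then the
    2 ^ m signed sums of the vectors, halved, are pairwise at distance at least
    1, since the difference of two of them is a combination with coefficients
    in {-1, 0, 1}.  A random signed sum has mean square norm m, so these points
    essentially live in a ball of radius of order sqrt m, and there is room for
    only O(sqrt m) ^ n of them.  Instead of comparing volumes, the points are
    rounded to cells of side 1 / sqrt n and the cells are counted with
    exponentially decaying weights; this gives [unbalanced_le], that is
    2 ^ m <= (e (2 + sqrt m)) ^ n, and hence m <= (1/2 + o(1)) n log n.

    Lower bound.  Suppose that for each i of a range of about (log n) / 2 values
    there are n (1 - o(1)) subsets of the n coordinates, all of size 4 ^ i, such
    that the sum modulo 2 of any nonempty collection of them has weight at least
    4 ^ i.  The vectors equal to 2 ^ -i on such a set and to 0 elsewhere are unit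
    vectors, and together they are not selectively balancing: if i is the largest
    layer used by a nonzero combination, then modulo 2 ^ (1 - i) only this layer
    is visible, so at least 4 ^ i coordinates of the sum are odd multiples of
    2 ^ -i ([layers_norm_ge1]).

    Each layer is therefore a binary code of rate near 1 generated by words whose
    weight equals the minimum distance.  Such codes are found at random
    ([parity_code_base]): cut the coordinates into w blocks of constant size b
    and let every word pick one coordinate in each block.  A sum of an odd number
    of words is odd in each block, hence has weight at least w without any
    probability; for even sums the generating function of the weight is a moment
    of a sum of b biased signs ([sum_exp_nb_odd]), small enough for a union bound
    over all sets of words as long as the number of words is at most
    w (b - log b - 3) - 1.  Disjoint copies extend this to every length
    ([parity_code_dense]). *)

(** * Random signs with a bias *)

(** The law of independent random signs of mean theta, a sign vector being
    encoded by the set S of its negative positions ([sgn_in] is the sign at c). *)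
Definition sign_wt {R : realType} {T : finType} (theta : R) (S : {set T}) : R :=
  \prod_c (if c \in S then (1 - theta) / 2 else (1 + theta) / 2).

Definition sgn_in {R : realType} {T : finType} (S : {set T}) (c : T) : R :=
  (-1) ^+ (c \in S).

Lemma sign_wt_ge0 (R : realType) (T : finType) (theta : R) (S : {set T}) :
  -1 <= theta <= 1 -> 0 <= sign_wt theta S.
Proof.
move=> /andP[h1 h2]; apply: prodr_ge0 => c _.
by case: ifP => _; lra.
Qed.

Lemma sum_sign_wt (R : realType) (T : finType) (theta : R) :
  \sum_(S : {set T}) sign_wt theta S = 1.
Proof.
transitivity (\prod_(c : T) ((1 - theta) / 2 + (1 + theta) / 2)).
  by rewrite bigA_distr.
by apply: big1 => c _; field.
Qed.

(** Distinct signs are independent, and a sign has square 1. *)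
Lemma sum_sign_wt_pair (R : realType) (T : finType) (theta : R) (d e : T) :
  \sum_(S : {set T}) sign_wt theta S * (sgn_in S d * sgn_in S e) =
  if d == e then 1 else theta ^+ 2.
Proof.
have [->|de] := eqVneq d e.
  rewrite -(sum_sign_wt _ T theta); apply: eq_bigr => S _.
  by rewrite -expr2 sqrr_sign mulr1.
pose h (c x : T) : R := (if c == x then -1 else 1).
have hS (S : {set T}) x : sgn_in S x = \prod_c (if c \in S then h c x else 1).
  rewrite (bigD1 x) //= big1 ?mulr1 /h ?eqxx /sgn_in.
    by case: (x \in S).
  by move=> c /negbTE ->; case: ifP.
transitivity (\prod_(c : T) ((1 - theta) / 2 * (h c d * h c e) + (1 + theta) / 2)).
  rewrite bigA_distr; apply: eq_bigr => S _.
  rewrite !hS -!big_split /=; apply: eq_bigr => c _.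
  by case: ifP => _; rewrite ?mulr1.
rewrite (bigD1 d) //= (bigD1 e) 1?eq_sym //= big1 ?mulr1 => [|c /andP[cd ce]].
  by rewrite /h !eqxx (negbTE de) eq_sym (negbTE de); field.
by rewrite /h (negbTE cd) (negbTE ce); field.
Qed.

Lemma sign_second_moment (R : realType) (T : finType) (theta : R) (a : T -> R) :
  \sum_(S : {set T}) sign_wt theta S * (\sum_c a c * sgn_in S c) ^+ 2 =
  (1 - theta ^+ 2) * (\sum_c a c ^+ 2) + theta ^+ 2 * (\sum_c a c) ^+ 2.
Proof.
transitivity (\sum_d \sum_e a d * a e * (if d == e then 1 else theta ^+ 2)).
  under eq_bigr => S _.
    rewrite expr2 mulr_sumr mulr_sumr.
    under eq_bigr do rewrite mulr_suml mulr_sumr.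
    over.
  rewrite exchange_big; apply: eq_bigr => d _ /=.
  rewrite exchange_big; apply: eq_bigr => e _ /=.
  rewrite -sum_sign_wt_pair mulr_sumr; apply: eq_bigr => S _; ring.
rewrite [X in _ + _ * X]expr2 mulr_suml !mulr_sumr -big_split /=; apply: eq_bigr => d _.
rewrite mulr_sumr mulr_sumr !(bigD1 (P := xpredT) d) //= eqxx.
rewrite [X in _ + X = _](eq_bigr (fun e => theta ^+ 2 * (a d * a e))).
  by ring.
by move=> e; rewrite eq_sym => /negbTE ->; ring.
Qed.

(** * Counting the cells of signed sums *)

Lemma truncn_signed_dist (R : realType) (y z : R) :
  (y < 0) = (z < 0) -> Num.truncn `|y| = Num.truncn `|z| -> `|y - z| < 1.
Proof.
move=> s t.
have /andP[y1 y2] := truncn_itv (normr_ge0 y).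
have /andP[z1 z2] := truncn_itv (normr_ge0 z).
rewrite t -natr1 in y1 y2; rewrite -natr1 in z2.
move: (_%:R) y1 y2 z1 z2 => k y1 y2 z1 z2; rewrite ltr_norml.
have [y0|y0] := ltP y 0.
  rewrite y0 in s.
  rewrite (ltr0_norm y0) in y1 y2; rewrite (ltr0_norm (esym s)) in z1 z2.
  by apply/andP; split; lra.
have z0 : 0 <= z by rewrite leNgt -s -leNgt.
rewrite (ger0_norm y0) in y1 y2; rewrite (ger0_norm z0) in z1 z2.
by apply/andP; split; lra.
Qed.

Lemma sum_expR_le (R : realType) (tau : R) (M : nat) : 0 < tau ->
  \sum_(k < M) expR (- tau * k%:R) <= 1 + tau^-1.
Proof.
move=> tau0; set x := expR (- tau).
have x1 : x * (1 + tau) <= 1.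
  rewrite /x expRN mulrC ler_pdivrMr ?expR_gt0 // mul1r; exact: expR_ge1Dx.
have x0 : 0 < x by exact: expR_gt0.
have -> : \sum_(k < M) expR (- tau * k%:R) = \sum_(k < M) x ^+ k.
  by apply: eq_bigr => k _; rewrite expRM_natr.
set s := \sum_(k < M) _.
have hs : (1 - x) * s <= 1.
  have -> : (1 - x) * s = 1 - x ^+ M by rewrite -opprB mulNr -subrX1; ring.
  by rewrite gerBl exprn_ge0 // ltW.
have h : tau * s <= 1 + tau.
  have -> : tau * s = (1 + tau) * ((1 - x) * s) - (1 - x * (1 + tau)) * s by ring.
  have s0 : 0 <= s by apply: sumr_ge0 => k _; rewrite exprn_ge0 // ltW.
  have : 0 <= (1 - x * (1 + tau)) * s by rewrite mulr_ge0 // subr_ge0.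
  have : (1 + tau) * ((1 - x) * s) <= (1 + tau) * 1 by rewrite ler_wpM2l //; lra.
  lra.
by rewrite -(ler_pM2l tau0) mulrDr mulr1 divff ?gt_eqF // addrC.
Qed.

Lemma enorm_eq1 (R : realType) (n : nat) (x : 'rV[R]_n) :
  enorm x = 1 -> \sum_j x 0 j ^+ 2 = 1.
Proof.
rewrite /enorm => h; rewrite -[LHS]sqr_sqrtr ?h ?expr1n //.
by apply: sumr_ge0 => j _; exact: sqr_ge0.
Qed.

Lemma enorm_lt1 (R : realType) (n : nat) (x : 'rV[R]_n) :
  (enorm x < 1) = (\sum_j x 0 j ^+ 2 < 1).
Proof. by rewrite /enorm -[X in _ < X]sqrtr1 ltr_sqrt. Qed.

(** The halved signed sums s A fall into distinct cells.  Giving the cell of y the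
    weight exp (- tau |y|_1), with |y|_1 rounded down coordinatewise, the cells
    have total weight at most (2 (1 + 1 / tau)) ^ n.  By convexity the mean of
    the weights is at least exp (- tau E), where E = n (sqrt m) / 2 bounds the
    mean of the rescaled |s A|_1; the choice tau = 2 / sqrt m makes tau E = n. *)
Lemma unbalanced_le (R : realType) (n m : nat) (u : 'I_m -> 'rV[R]_n) :
  (0 < n)%N -> (0 < m)%N -> (forall i, enorm (u i) = 1) ->
  ~ selectively_balancing u ->
  2 ^+ m <= (expR 1 * (2 + Num.sqrt m%:R)) ^+ n :> R.
Proof.
move=> n0 m0 u1 nbal.
have nR : 0 < n%:R :> R by rewrite ltr0n.
have mR : 0 < m%:R :> R by rewrite ltr0n.
pose rn : R := Num.sqrt n%:R; pose rm : R := Num.sqrt m%:R.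
have rn0 : 0 < rn by rewrite sqrtr_gt0.
have rm0 : 0 < rm by rewrite sqrtr_gt0.
have rn2 : rn ^+ 2 = n%:R by rewrite sqr_sqrtr // ltW.
have rm2 : rm ^+ 2 = m%:R by rewrite sqr_sqrtr // ltW.
pose s (A : {set 'I_m}) j : R := 2^-1 * \sum_i u i 0 j * sgn_in A i.
pose k A j := Num.truncn `|rn * s A j|.
pose M := (\sum_A \sum_j k A j)%N.
have kM A j : (k A j < M.+1)%N.
  by rewrite ltnS /M (bigD1 A) //= (bigD1 j) //= -addnA leq_addr.
(* A cell of the line: a sign bit and the integer part of the absolute value.
   Two points in the same cell are at distance less than 1. *)
pose z A : {ffun 'I_n -> bool * 'I_M.+1} :=
  [ffun j => (rn * s A j < 0, inord (k A j))].
have z_inj : injective z.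
  move=> A B zAB; apply: contrapT => AB; apply: nbal.
  exists (fun i => 2^-1 * (sgn_in A i - sgn_in B i)); split.
  - move=> i; rewrite /sgn_in !inE.
    case: (i \in A); case: (i \in B) => /=; rewrite ?expr0 ?expr1.
    + by rewrite subrr mulr0 eqxx orbT.
    + by apply/orP; left; apply/eqP; field.
    + by apply/orP; right; apply/orP; right; apply/eqP; field.
    + by rewrite subrr mulr0 eqxx orbT.
  - apply: contrapT => h; apply: AB; apply/setP => i.
    have : (2^-1 * (sgn_in A i - sgn_in B i) == 0 :> R).
      by apply: contra_notT h => ?; exists i.
    rewrite mulf_eq0 invr_eq0 pnatr_eq0 /= subr_eq0 /sgn_in.
    have neq : (-1 == 1 :> R) = false by apply/negP => /eqP; lra.
    case: (i \in A); case: (i \in B) => //=; rewrite ?expr0 ?expr1 ?neq //.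
    by rewrite eq_sym neq.
  rewrite enorm_lt1.
  have e j : (\sum_i (2^-1 * (sgn_in A i - sgn_in B i)) *: u i) 0 j = s A j - s B j.
    rewrite summxE /s -mulrBr -sumrB mulr_sumr; apply: eq_bigr => i _.
    by rewrite !mxE; ring.
  have d j : (s A j - s B j) ^+ 2 < n%:R^-1.
    have /ffunP/(_ j) := zAB; rewrite !ffunE => -[h1 h2].
    have h3 : k A j = k B j by have := congr1 val h2; rewrite /= !inordK.
    have := truncn_signed_dist _ _ _ h1 h3; rewrite -mulrBr => h.
    rewrite -(ltr_pM2l nR) divff ?gt_eqF // -rn2 -exprMn.
    by rewrite -real_normK ?num_real // expr_lt1.
  under eq_bigr do rewrite e.
  apply: (@lt_le_trans _ _ (\sum_(j < n) n%:R^-1)).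
    by apply: ltr_sum => // ; apply/hasP; exists (Ordinal n0); rewrite ?mem_index_enum.
  by rewrite sumr_const card_ord -[X in X <= _]mulr_natl divff // gt_eqF.
pose tau : R := 2 / rm.
have tau0 : 0 < tau by rewrite divr_gt0.
pose f (c : bool * 'I_M.+1) := expR (- tau * c.2%:R).
have upper : \sum_A \prod_j f (z A j) <= (2 + rm) ^+ n.
  apply: (@le_trans _ _ (\sum_(v : {ffun 'I_n -> bool * 'I_M.+1}) \prod_j f (v j))).
    have -> : \sum_A \prod_j f (z A j) =
        \sum_(A in [set: {set 'I_m}]%SET) \prod_j f (z A j).
      by apply: eq_bigl => A; rewrite finset.inE.
    rewrite -(big_imset (fun v : {ffun 'I_n -> bool * 'I_M.+1} => \prod_j f (v j))) /=; last first.
      by move=> A B _ _; exact: z_inj.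
    rewrite [leRHS](bigID (mem (z @: [set: {set 'I_m}]%SET))) /= lerDl.
    by apply: sumr_ge0 => v _; apply: prodr_ge0 => j _; exact: expR_ge0.
  rewrite -(bigA_distr_bigA (fun _ => f)) prodr_const card_ord.
  apply: lerXn2r; rewrite ?nnegrE; first by apply: sumr_ge0 => c _; exact: expR_ge0.
    by lra.
  rewrite -(pair_bigA _ (fun b i => f (b, i))) /= big_bool /f /=.
  have := sum_expR_le _ _ M.+1 tau0; rewrite /tau invf_div; lra.
pose Y A := rn * \sum_j `|s A j|.
(* The typical size of a coordinate of s A; it balances the two terms of
   2 |s| <= s ^ 2 / al + al in the proof of meanY below. *)
pose al : R := rm / rn / 2.
have al0 : 0 < al by rewrite !divr_gt0.
have lower A : expR (- tau * Y A) <= \prod_j f (z A j).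
  rewrite /Y mulr_sumr mulr_sumr expR_sum; apply: ler_prod => j _.
  rewrite expR_ge0 ler_expR /z ffunE /= inordK // !mulNr lerN2 ler_wpM2l ?(ltW tau0) //.
  have -> : rn * `|s A j| = `|rn * s A j| by rewrite [RHS]normrM (gtr0_norm rn0).
  by rewrite truncn_le.
have wt0 (A : {set 'I_m}) : sign_wt 0 A = 2^-1 ^+ m :> R.
  rewrite /sign_wt (eq_bigr (fun=> 2^-1)) ?prodr_const ?card_ord // => c _.
  by case: ifP => _; rewrite ?subr0 ?addr0 mul1r.
have meanY : \sum_A sign_wt 0 A * Y A <= n%:R * rm / 2.
  have Yle A : Y A <= rn / 2 * \sum_j (s A j ^+ 2 / al + al).
    rewrite /Y -mulrA ler_wpM2l ?(ltW rn0) // mulr_sumr; apply: ler_sum => j _.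
    rewrite -(real_normK (num_real _)); set y := `|_|.
    have : 0 <= (y - al) ^+ 2 / al by rewrite divr_ge0 ?sqr_ge0 // ltW.
    have -> : (y - al) ^+ 2 / al = y ^+ 2 / al - 2 * y + al by field; rewrite gt_eqF.
    lra.
  have s2 j : \sum_A sign_wt 0 A * s A j ^+ 2 = 4^-1 * \sum_i u i 0 j ^+ 2.
    under eq_bigr do rewrite /s exprMn mulrCA.
    by rewrite -mulr_sumr sign_second_moment; field.
  apply: (@le_trans _ _ (\sum_A sign_wt 0 A * (rn / 2 * \sum_j (s A j ^+ 2 / al + al)))).
    by apply: ler_sum => A _; rewrite ler_wpM2l // sign_wt_ge0; lra.
  under eq_bigr => A _ do rewrite mulrCA mulr_sumr.
  rewrite -mulr_sumr exchange_big /=.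
  under eq_bigr => j _.
    under eq_bigr do rewrite mulrDr mulrA.
    rewrite big_split /= -!mulr_suml s2 sum_sign_wt mul1r.
    over.
  rewrite big_split /= -mulr_suml -mulr_sumr exchange_big /=.
  rewrite (eq_bigr (fun=> 1)); last by move=> i _; exact: enorm_eq1.
  rewrite !sumr_const !card_ord -[al *+ n]mulr_natl -rm2 -rn2 /al.
  rewrite [X in X <= _](_ : _ = rn ^+ 2 * rm / 2) //; field.
  by rewrite !gt_eqF.
(* Convexity: exp is above its tangent line at - n. *)
have main : expR (- n%:R) <= \sum_A sign_wt 0 A * expR (- tau * Y A).
  apply: (@le_trans _ _ (\sum_A expR (- n%:R) * (sign_wt 0 A * (1 + n%:R) - tau * (sign_wt 0 A * Y A)))).
    rewrite -mulr_sumr ler_peMr ?expR_ge0 // sumrB -mulr_suml -mulr_sumr sum_sign_wt mul1r.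
    have h : tau * \sum_A sign_wt 0 A * Y A <= tau * (n%:R * rm / 2).
      by rewrite ler_wpM2l // ltW.
    have e : tau * (n%:R * rm / 2) = n%:R by rewrite /tau; field; rewrite gt_eqF.
    by rewrite e in h; lra.
  apply: ler_sum => A _.
  have -> : - tau * Y A = - n%:R + (n%:R - tau * Y A) by ring.
  rewrite expRD.
  have := expR_ge1Dx (n%:R - tau * Y A).
  have wA : 0 <= sign_wt (0 : R) A by rewrite sign_wt_ge0; lra.
  move=> /(ler_wpM2l wA) /(ler_wpM2l (expR_ge0 (- n%:R))).
  by congr (_ <= _); ring.
have fin : expR (- n%:R) <= 2^-1 ^+ m * (2 + rm) ^+ n.
  apply: (le_trans main); rewrite (eq_bigr (fun A => 2^-1 ^+ m * expR (- tau * Y A))).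
    rewrite -mulr_sumr ler_wpM2l ?exprn_ge0 ?invr_ge0 //.
    by apply: le_trans upper; apply: ler_sum => A _.
  by move=> A _; rewrite wt0.
rewrite exprMn -expRM_natl mulr1.
move: fin; rewrite expRN exprVn mulrC ler_pdivlMr ?exprn_gt0 //.
by rewrite mulrC ler_pdivrMr ?expR_gt0 // mulrC.
Qed.

(** * Codes generated by words of minimum weight *)

(** The sum modulo 2 of the words A x, x in J. *)
Definition odd_cover {I V : finType} (A : I -> {set V}) (J : {set I}) : {set V} :=
  [set v | odd #|[set x in J | v \in A x]%SET|]%SET.

(** The weight of the generators is required to equal the lower bound w on the
    minimum distance exactly: after scaling by w ^ (-1/2), the former makes unit
    vectors and the latter gives norm at least 1. *)
Definition parity_code (I V : finType) (w : nat) : Prop :=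
  exists A : I -> {set V}, (forall x, #|A x| = w) /\
    forall J : {set I}, J != finset.set0 -> (w <= #|odd_cover A J|)%N.

(** The weight, inside one block T, of the sum modulo 2 over J, when the word j
    picks the single coordinate y j of the block. *)
Definition nb_odd {I T : finType} (J : {set I}) (y : {ffun I -> T}) : nat :=
  #|[set c | odd #|[set j in J | y j == c]%SET|]%SET|.

(** Fourier expansion: theta ^ odd k = (1 + theta) / 2 + (1 - theta) / 2 * (-1) ^ k
    for the number k of words picking c, multiplied out over all c. *)
Lemma exp_nb_odd (R : realType) (I T : finType) (theta : R) (J : {set I})
    (y : {ffun I -> T}) :
  theta ^+ nb_odd J y =
  \sum_(S : {set T}) sign_wt theta S * \prod_(j in J) sgn_in S (y j).
Proof.
pose cnt c := #|[set j in J | y j == c]%SET|.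
transitivity (\prod_c ((1 - theta) / 2 * (-1) ^+ cnt c + (1 + theta) / 2)).
  rewrite /nb_odd -prodr_const big_mkcond /=; apply: eq_bigr => c _.
  rewrite finset.inE -[(-1) ^+ cnt c]signr_odd /cnt.
  by case: (odd _); rewrite ?expr1 ?expr0; field.
rewrite bigA_distr; apply: eq_bigr => S _.
have -> : \prod_(j in J) sgn_in S (y j) = \prod_c (sgn_in S c) ^+ cnt c :> R.
  rewrite (partition_big y xpredT) //=; apply: eq_bigr => c _.
  rewrite (eq_bigr (fun=> sgn_in S c)); last by move=> j /andP[_ /eqP ->].
  rewrite prodr_const; congr (_ ^+ _); apply: eq_card => j.
  by rewrite finset.inE.
rewrite -big_split /=; apply: eq_bigr => c _; rewrite /sgn_in.
by case: ifP => _; rewrite ?expr1n ?mulr1 // expr1.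
Qed.

(** Up to normalization, the generating function of the weight of a sum of #|J|
    uniform independent picks is the moment of order #|J| of the average of #|T|
    independent signs of mean theta. *)
Lemma sum_exp_nb_odd (R : realType) (I T : finType) (theta : R) (J : {set I}) :
  \sum_(y : {ffun I -> T}) theta ^+ nb_odd J y =
  \sum_(S : {set T}) sign_wt theta S *
    ((\sum_c sgn_in S c) ^+ #|J| * #|T|%:R ^+ #|~: J|).
Proof.
under eq_bigr do rewrite exp_nb_odd.
rewrite exchange_big; apply: eq_bigr => S _ /=.
rewrite -mulr_sumr; congr (_ * _).
rewrite (eq_bigr (fun y : {ffun I -> T} =>
    \prod_j (if j \in J then sgn_in S (y j) else 1))); last by move=> y _; rewrite big_mkcond.
rewrite -(bigA_distr_bigA (fun j c => if j \in J then sgn_in S c else 1 : R)).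
rewrite (bigID (mem J)) /=; congr (_ * _).
  rewrite (eq_bigr (fun=> \sum_c sgn_in S c)) ?prodr_const // => j jJ.
  by apply: eq_bigr => c _; rewrite jJ.
rewrite (eq_bigl (fun j => j \in (~: J)%SET)) => [|j]; last by rewrite /= finset.in_setC.
rewrite (eq_bigr (fun=> #|T|%:R)) ?prodr_const // => j.
rewrite finset.inE => /negbTE jJ.
by rewrite (eq_bigr (fun=> 1)) => [|c _]; rewrite ?jJ // sumr_const.
Qed.

Lemma sum_sgn_in (R : realType) (T : finType) (S : {set T}) :
  \sum_c sgn_in S c = #|T|%:R - 2 * #|S|%:R :> R.
Proof.
rewrite (eq_bigr (fun c => 1 - 2 * (c \in S)%:R)); last first.
  by move=> c _; rewrite /sgn_in; case: (c \in S) => /=; rewrite ?expr0 ?expr1; ring.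
rewrite sumrB sumr_const -mulr_sumr; congr (_ - _ * _).
rewrite -sum1_card natr_sum [RHS]big_mkcond /=.
by apply: eq_bigr => c _; case: (c \in S).
Qed.

(** The average of the signs is at most 1 in absolute value, so an even moment of
    positive order is at most the second one. *)
Lemma sum_exp_nb_odd_le_even (R : realType) (I T : finType) (theta : R) (J : {set I}) :
  0 <= theta <= 1 -> (0 < #|T|)%N -> J != finset.set0 -> ~~ odd #|J| ->
  \sum_(y : {ffun I -> T}) theta ^+ nb_odd J y <=
  #|T|%:R ^+ #|I| * (#|T|%:R^-1 + theta ^+ 2).
Proof.
move=> th T0 J0 oJ; rewrite sum_exp_nb_odd.
set b : R := #|T|%:R; have b0 : 0 < b by rewrite ltr0n.
have [a Ja] : exists a, (#|J| = (a.*2).+2)%N.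
  exists (#|J|./2.-1); move: J0 oJ; rewrite -card_gt0; move: #|J| => k; lia.
have wt0 (S : {set T}) : 0 <= sign_wt theta S by rewrite sign_wt_ge0; lra.
apply: (@le_trans _ _ (\sum_(S : {set T})
    (b ^+ a.*2 * b ^+ #|~: J|) * (sign_wt theta S * (\sum_c sgn_in S c) ^+ 2))).
  apply: ler_sum => S _.
  have -> : b ^+ a.*2 * b ^+ #|~: J| * (sign_wt theta S * (\sum_c sgn_in S c) ^+ 2) =
    sign_wt theta S * (((\sum_c sgn_in S c) ^+ 2 * b ^+ a.*2) * b ^+ #|~: J|) by ring.
  rewrite ler_wpM2l // ler_wpM2r ?exprn_ge0 ?(ltW b0) // Ja -addn2 addnC exprD.
  rewrite ler_wpM2l ?sqr_ge0 // -mul2n !exprM lerXn2r ?nnegrE ?sqr_ge0 //.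
  rewrite -(real_normK (num_real (\sum_c _))) lerXn2r ?nnegrE ?(ltW b0) //.
  rewrite sum_sgn_in -/b.
  have : #|S|%:R <= b by rewrite ler_nat max_card.
  have : 0 <= #|S|%:R :> R by [].
  by rewrite ler_norml; lra.
rewrite -mulr_sumr.
have := sign_second_moment _ T theta (fun=> 1).
rewrite (eq_bigr (fun S => sign_wt theta S * (\sum_c sgn_in S c) ^+ 2)); last first.
  by move=> S _; under [X in _ * X ^+ 2]eq_bigr do rewrite mul1r.
move=> ->.
rewrite expr1n sumr_const -[1 *+ _]/(#|T|%:R) -/b.
have -> : b ^+ #|I| = b ^+ a.*2 * b ^+ #|~: J| * b ^+ 2.
  by rewrite -!exprD -(cardsC J) Ja; congr (_ ^+ _); lia.
rewrite -[leRHS]mulrA ler_wpM2l ?mulr_ge0 ?exprn_ge0 ?(ltW b0) //.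
have -> : b ^+ 2 * (b^-1 + theta ^+ 2) = b + theta ^+ 2 * b ^+ 2.
  by field; rewrite gt_eqF.
rewrite lerD2r; have := mulr_ge0 (sqr_ge0 theta) (ltW b0); lra.
Qed.

(** Unless all signs agree, their average is at most 1 - 2 / #|T| in absolute
    value, so high moments only see the two constant sign vectors. *)
Lemma sum_exp_nb_odd_le_large (R : realType) (I T : finType) (theta : R) (J : {set I}) :
  0 <= theta <= 1 -> (1 < #|T|)%N -> ~~ odd #|J| ->
  \sum_(y : {ffun I -> T}) theta ^+ nb_odd J y <=
  #|T|%:R ^+ #|I| * (((1 + theta) / 2) ^+ #|T| + ((1 - theta) / 2) ^+ #|T| +
     (1 - 2 / #|T|%:R) ^+ #|J|).
Proof.
move=> th T1 oJ; rewrite sum_exp_nb_odd.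
have T0 : (0 < #|T|)%N by apply: ltn_trans T1.
set b : R := #|T|%:R; have b0 : 0 < b by rewrite ltr0n.
have b2 : 2 <= b by rewrite ler_nat.
have wt0 (S : {set T}) : 0 <= sign_wt theta S by rewrite sign_wt_ge0; lra.
pose r : R := 1 - 2 / b.
have r0 : 0 <= r by rewrite subr_ge0 ler_pdivrMr // mul1r.
pose M (S : {set T}) : R := (S == finset.set0)%:R + (S == [set: T]%SET)%:R + r ^+ #|J|.
have key (S : {set T}) : (\sum_c sgn_in S c) ^+ #|J| <= b ^+ #|J| * M S.
  have -> : (\sum_c sgn_in S c) ^+ #|J| = `|\sum_c sgn_in S c : R| ^+ #|J|.
    by rewrite -normrX ger0_norm // real_exprn_even_ge0 ?num_real.
  rewrite sum_sgn_in -/b.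
  have Sb : #|S|%:R <= b by rewrite ler_nat max_card.
  have S0' : 0 <= #|S|%:R :> R by [].
  have nb : `|b - 2 * #|S|%:R| <= b by rewrite ler_norml; lra.
  have rJ : 0 <= r ^+ #|J| by rewrite exprn_ge0.
  have [S0|S0] := eqVneq S finset.set0.
    apply: (@le_trans _ _ (b ^+ #|J| * 1)); first by rewrite mulr1 lerXn2r ?nnegrE ?(ltW b0).
    rewrite ler_wpM2l ?exprn_ge0 ?(ltW b0) // /M S0 eqxx.
    by rewrite -addrA lerDl addr_ge0.
  have [S1|S1] := eqVneq S ([set: T]%SET : {set T}).
    apply: (@le_trans _ _ (b ^+ #|J| * 1)); first by rewrite mulr1 lerXn2r ?nnegrE ?(ltW b0).
    rewrite ler_wpM2l ?exprn_ge0 ?(ltW b0) // /M S1 eqxx.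
    by rewrite addrAC lerDr addr_ge0.
  rewrite /M (negbTE S0) (negbTE S1) !add0r -exprMn.
  have -> : b * r = b - 2 by rewrite /r; field; rewrite gt_eqF.
  rewrite lerXn2r ?nnegrE ?subr_ge0 //.
  have h1 : 1 <= #|S|%:R :> R by rewrite ler1n card_gt0.
  have h2 : #|S|%:R + 1 <= b.
    by rewrite natr1 ler_nat -cardsT proper_card // properT.
  by rewrite ler_norml; lra.
apply: (@le_trans _ _ (\sum_(S : {set T}) b ^+ #|I| * (sign_wt theta S * M S))).
  apply: ler_sum => S _.
  have -> : b ^+ #|I| = b ^+ #|J| * b ^+ #|~: J| by rewrite -exprD cardsC.
  have -> : b ^+ #|J| * b ^+ #|~: J| * (sign_wt theta S * M S) =
     sign_wt theta S * ((b ^+ #|J| * M S) * b ^+ #|~: J|) by ring.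
  by rewrite ler_wpM2l // ler_wpM2r ?exprn_ge0 ?(ltW b0).
rewrite -mulr_sumr ler_wpM2l ?exprn_ge0 ?(ltW b0) //.
have -> : \sum_(S : {set T}) sign_wt theta S * M S =
  sign_wt theta (finset.set0 : {set T}) + sign_wt theta ([set: T]%SET : {set T}) + r ^+ #|J|.
  rewrite /M; under eq_bigr do rewrite !mulrDr.
  rewrite !big_split /= -mulr_suml sum_sign_wt mul1r; congr (_ + _ + _).
    rewrite (bigD1 finset.set0) //= eqxx mulr1 big1 ?addr0 // => S /negbTE ->.
    by rewrite mulr0.
  rewrite (bigD1 ([set: T]%SET : {set T})) //= eqxx mulr1 big1 ?addr0 // => S /negbTE ->.
  by rewrite mulr0.
rewrite lerD2r /sign_wt.
rewrite (eq_bigr (fun=> (1 + theta) / 2)) => [|c _]; last by rewrite finset.inE.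
rewrite [X in _ + X <= _](eq_bigr (fun=> (1 - theta) / 2)) => [|c _]; last by rewrite finset.inE.
by rewrite !prodr_const.
Qed.

Lemma expR_le_inv1B (R : realType) (x : R) : x < 1 -> expR x <= (1 - x)^-1.
Proof.
move=> x1; rewrite -[leLHS]invrK lef_pV2 ?posrE ?invr_gt0 ?expR_gt0 ?subr_gt0 //.
by rewrite -expRN expR_ge1Dx.
Qed.

Lemma expR2_le10 (R : realType) : expR 2 <= 10 :> R.
Proof.
have h : expR (4^-1) <= 4 / 3 :> R.
  by have := expR_le_inv1B R 4^-1 ltac:(lra); rewrite (_ : (1 - 4^-1)^-1 = 4 / 3) //; field.
have -> : expR 2 = expR (4^-1) ^+ 8 :> R by rewrite -expRM_natl; congr expR; field.
apply: (@le_trans _ _ ((4 / 3) ^+ 8)); last lra.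
by rewrite lerXn2r ?nnegrE ?expR_ge0.
Qed.

(** Here G is the factor contributed by each block to the Markov bound on the
    probability that the sum over J has weight below the number of blocks.  One
    value of theta serves two regimes: the constant bound is enough for small J,
    which are few, and the bound for large J is 2 ^ - b up to a factor linear in
    b, which is close to optimal because a block has only 2 ^ (b - 1) vectors of
    even weight. *)
Lemma sum_exp_nb_odd_le (R : realType) (I T : finType) (J : {set I}) :
  (8 <= #|T|)%N -> J != finset.set0 -> ~~ odd #|J| ->
  let b : R := #|T|%:R in let theta := 2 / b in
  let G := (\sum_(y : {ffun I -> T}) theta ^+ nb_odd J y) / (b ^+ #|I| * theta) in
  G <= 3 / 4 /\ ((#|T| ^ 2 <= #|J|)%N -> G <= 8 * b / 2 ^+ #|T|).
Proof.
move=> T8 J0 oJ b theta G.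
have b8 : 8 <= b by rewrite ler_nat.
have b0 : 0 < b by lra.
have t0 : 0 < theta by rewrite divr_gt0.
have tb : theta * b = 2 by rewrite /theta divfK // gt_eqF.
have t1 : theta <= 4^-1 by rewrite /theta ler_pdivrMr //; lra.
have th : 0 <= theta <= 1 by lra.
have N0 : 0 < b ^+ #|I| by rewrite exprn_gt0.
have Nt : 0 < b ^+ #|I| * theta by rewrite mulr_gt0.
split.
  rewrite /G ler_pdivrMr //.
  apply: (le_trans (sum_exp_nb_odd_le_even R I T theta J th _ J0 oJ)); first lia.
  have -> : 3 / 4 * (b ^+ #|I| * theta) = b ^+ #|I| * (3 / 4 * theta) by ring.
  rewrite ler_wpM2l ?(ltW N0) // -/b.
  have -> : b^-1 = theta / 2 by rewrite /theta; field; rewrite gt_eqF.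
  have : theta * theta <= theta * 4^-1 by rewrite ler_wpM2l // ltW.
  rewrite expr2; lra.
move=> bJ; rewrite /G ler_pdivrMr //.
apply: (le_trans (sum_exp_nb_odd_le_large R I T theta J th _ oJ)); first lia.
have -> : 8 * b / 2 ^+ #|T| * (b ^+ #|I| * theta) = b ^+ #|I| * (16 / 2 ^+ #|T|).
  have -> : theta = 2 / b by [].
  by field; rewrite expf_neq0 //= gt_eqF.
rewrite ler_wpM2l ?(ltW N0) // -/b -/theta.
have e1 : ((1 + theta) / 2) ^+ #|T| <= 10 / 2 ^+ #|T|.
  rewrite expr_div_n ler_wpM2r ?invr_ge0 ?exprn_ge0 //.
  apply: (@le_trans _ _ (expR theta ^+ #|T|)).
    by rewrite lerXn2r ?nnegrE ?expR_ge0 ?expR_ge1Dx //; lra.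
  by rewrite -expRM_natr -/b tb expR2_le10.
have e2 : ((1 - theta) / 2) ^+ #|T| <= 1 / 2 ^+ #|T|.
  rewrite expr_div_n ler_wpM2r ?invr_ge0 ?exprn_ge0 //.
  by rewrite exprn_ile1 //; lra.
have e3 : (1 - theta) ^+ #|J| <= 1 / 2 ^+ #|T|.
  apply: (@le_trans _ _ ((1 - theta) ^+ (#|T| ^ 2))).
    by apply: ler_wiXn2l => //; lra.
  apply: (@le_trans _ _ (expR (- theta) ^+ (#|T| ^ 2))).
    by rewrite lerXn2r ?nnegrE ?expR_ge0 ?expR_ge1Dx //; lra.
  rewrite -expRM_natr -mulnn natrM -/b mulrA mulNr tb mulNr expRN expRM_natr.
  rewrite div1r lef_pV2 ?posrE ?exprn_gt0 ?expR_gt0 //.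
  rewrite lerXn2r ?nnegrE ?expR_ge0 //.
  have := expR_ge1Dx (2 : R); lra.
have : 0 < (2 ^+ #|T|)^-1 :> R by rewrite invr_gt0 exprn_gt0.
lra.
Qed.

(** The numbers of words picking the various c add up to #|J|. *)
Lemma nb_odd_gt0 (I T : finType) (J : {set I}) (y : {ffun I -> T}) :
  odd #|J| -> (0 < nb_odd J y)%N.
Proof.
move=> oJ; rewrite card_gt0; apply/negP => /eqP E.
have : #|J| = (\sum_c #|[set j in J | y j == c]%SET|)%N.
  rewrite -sum1_card (partition_big y xpredT) //=; apply: eq_bigr => c _.
  by rewrite -sum1_card; apply: eq_bigl => j; rewrite finset.inE.
move=> e; move: oJ; rewrite e; apply/negP.
apply: (big_ind (fun k => ~~ odd k)) => // [k l hk hl|c _].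
  by rewrite oddD (negbTE hk) (negbTE hl).
by move/setP/(_ c): E; rewrite !finset.inE => ->.
Qed.

Lemma card_set_pair (W T : finType) (P : pred (W * T)) :
  #|[set v | P v]%SET| = (\sum_l #|[set c | P (l, c)]%SET|)%N.
Proof.
rewrite [RHS](eq_bigr (fun l => \sum_c if P (l, c) then 1 else 0)%N).
  rewrite -sum1_card big_mkcond pair_bigA /=; apply: eq_bigr => -[l c] _ /=.
  by rewrite finset.inE.
move=> l _; rewrite -sum1_card big_mkcond; apply: eq_bigr => c _.
by rewrite finset.inE.
Qed.

(** Union bound: for a uniformly random choice X of the words, the left-hand side
    bounds, by Markov's inequality for theta ^ weight, the expected number of even
    nonempty J whose sum has weight below #|W|. *)
Lemma parity_code_of_sum_lt1 (R : realType) (I W T : finType) (theta : R) :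
  0 < theta <= 1 -> (0 < #|T|)%N ->
  \sum_(J : {set I} | (J != finset.set0) && ~~ odd #|J|)
    ((\sum_(y : {ffun I -> T}) theta ^+ nb_odd J y)
       / (#|T|%:R ^+ #|I| * theta)) ^+ #|W| < 1 ->
  parity_code I (W * T)%type #|W|.
Proof.
move=> /andP[t0 t1] T0 hsum.
have [X hX] : exists X : {ffun W -> {ffun I -> T}}, forall J : {set I},
    J != finset.set0 -> (#|W| <= \sum_l nb_odd J (X l))%N.
  apply: contrapT => nX; move: hsum; apply/negP; rewrite -leNgt.
  have bad (X : {ffun W -> {ffun I -> T}}) : exists J : {set I},
      [&& J != finset.set0, ~~ odd #|J| & (\sum_l nb_odd J (X l) < #|W|)%N].
    apply: contrapT => nJ; apply: nX; exists X => J J0; rewrite leqNgt; apply/negP => h.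
    apply: nJ; exists J; rewrite J0 h andbT /=; apply/negP => oJ.
    move: h; apply/negP; rewrite -leqNgt -sum1_card.
    by apply: leq_sum => l _; exact: nb_odd_gt0.
  set N : R := #|T|%:R ^+ #|I|.
  have N0 : 0 < N by rewrite exprn_gt0 // ltr0n.
  have c0 : 0 < N ^+ #|W| by rewrite exprn_gt0.
  rewrite -(ler_pM2l c0) mulr1 mulr_sumr.
  pose E J : R := (\sum_(y : {ffun I -> T}) theta ^+ nb_odd J y) ^+ #|W| / theta ^+ #|W|.
  rewrite [leRHS](eq_bigr E); last first.
    by move=> J _; rewrite -exprMn /E -expr_div_n; congr (_ ^+ _); field; rewrite !gt_eqF.
  have eE J : E J = \sum_(X : {ffun W -> {ffun I -> T}})
      theta ^+ (\sum_l nb_odd J (X l)) / theta ^+ #|W|.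
    rewrite /E -mulr_suml; congr (_ / _).
    rewrite -prodr_const (bigA_distr_bigA (fun _ (y : {ffun I -> T}) => theta ^+ nb_odd J y)).
    by apply: eq_bigr => X _; rewrite expr_sum.
  rewrite (eq_bigr _ (fun J _ => eE J)) exchange_big /=.
  have -> : N ^+ #|W| = \sum_(X : {ffun W -> {ffun I -> T}}) 1.
    by rewrite sumr_const card_ffun card_ffun !natrX.
  apply: ler_sum => X _; have [J /and3P[J0 oJ h]] := bad X.
  rewrite (bigD1 J) ?J0 //= -[leLHS]addr0 lerD //.
    by rewrite ler_pdivlMr ?exprn_gt0 // mul1r ler_wiXn2l ?(ltW t0) // ltnW.
  by apply: sumr_ge0 => K _; rewrite divr_ge0 ?exprn_ge0 ?ltW.
exists (fun x => [set v : W * T | X v.1 x == v.2]%SET); split.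
  move=> x; rewrite (card_set_pair W T (fun v => X v.1 x == v.2)) /= -[RHS]sum1_card.
  apply: eq_bigr => l _; rewrite -(cards1 (X l x)); apply: eq_card => c.
  by rewrite !finset.inE eq_sym.
move=> J J0; apply: (leq_trans (hX J J0)).
rewrite /odd_cover card_set_pair; apply: leq_sum => l _; apply: subset_leq_card.
apply/fintype.subsetP => c; rewrite !finset.inE.
by congr (is_true (odd _)); apply: eq_card => j; rewrite !finset.inE.
Qed.

Lemma geometric_lt (R : realType) (q e : R) : 0 <= q < 1 -> 0 < e ->
  exists w0, forall w, (w0 <= w)%N -> q ^+ w < e.
Proof.
move=> /andP[q0 q1] e0.
have : q ^+ n @[n --> \oo] --> (0 : R) by apply: cvg_expr; rewrite ger0_norm.
move=> /cvgrPdist_lt/(_ _ e0)[w0 _ h]; exists w0 => w ww.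
by have := h w ww; rewrite /= sub0r normrN ger0_norm // exprn_ge0.
Qed.

(** The sets J of fewer than b ^ 2 words contribute little because there are few of
    them and (3/4) ^ w decays exponentially; the others, up to 2 ^ #|I| in number,
    are controlled by the hypothesis, which allows about w (b - log b - 3) words
    out of the w b coordinates. *)
Lemma parity_code_base (R : realType) (b : nat) : (8 <= b)%N ->
  exists w0, forall w, (w0 <= w)%N -> forall I : finType, (#|I| <= b * w)%N ->
    2 ^+ #|I| * (8 * b%:R / 2 ^+ b) ^+ w <= 2^-1 :> R ->
    parity_code I ('I_w * 'I_b)%type w.
Proof.
move=> b8; have bR : 8 <= b%:R :> R by rewrite ler_nat.
have b0 : 0 < b%:R :> R by lra.
(* The indicator of #|J| < b ^ 2 is bounded by x ^ #|J| / x ^ (b ^ 2), and the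
   value of x is small enough for (1 + x) ^ b * (3 / 4) to stay below 1. *)
pose x : R := (8 * b%:R)^-1.
have x0 : 0 < x by rewrite invr_gt0; lra.
have x1 : x <= 1 by rewrite invf_le1; lra.
have e0 : 0 < x ^+ (b ^ 2) / 2 by rewrite divr_gt0 ?exprn_gt0.
have [w0 hw0] := geometric_lt R (6 / 7) _ ltac:(lra) e0.
exists w0 => w ww I Ib I2.
rewrite -[w in parity_code _ _ w](card_ord w).
pose theta : R := 2 / b%:R.
have t0 : 0 < theta by rewrite divr_gt0.
have t1 : theta <= 1 by rewrite /theta ler_pdivrMr //; lra.
apply: (parity_code_of_sum_lt1 R _ _ _ theta); rewrite ?t0 ?card_ord //; first lia.
pose q : R := 8 * b%:R / 2 ^+ b.
have q0 : 0 <= q by rewrite divr_ge0 ?exprn_ge0 //; lra.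
apply: (@le_lt_trans _ _ (\sum_(J : {set I})
   ((3 / 4) ^+ w / x ^+ (b ^ 2) * x ^+ #|J| + q ^+ w))).
  rewrite big_mkcond; apply: ler_sum => J _.
  have h1 : 0 <= (3 / 4) ^+ w / x ^+ (b ^ 2) * x ^+ #|J|.
    by rewrite mulr_ge0 ?divr_ge0 ?exprn_ge0 //; lra.
  have h2 : 0 <= q ^+ w by rewrite exprn_ge0.
  case: ifP => [/andP[J0 oJ]|_]; last by rewrite addr_ge0.
  have := sum_exp_nb_odd_le R I 'I_b J; rewrite card_ord => /(_ b8 J0 oJ) /=.
  rewrite -/theta; set G := _ / _; move=> [G1 G2].
  have G0 : 0 <= G.
    rewrite divr_ge0 //; last by rewrite mulr_ge0 ?exprn_ge0 ?ltW.
    by apply: sumr_ge0 => y _; rewrite exprn_ge0 // ltW.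
  have [bJ|bJ] := leqP (b ^ 2)%N #|J|.
    rewrite -[leLHS]add0r lerD // lerXn2r ?nnegrE //; exact: G2.
  rewrite -[leLHS]addr0 lerD // -mulrA mulrC; apply: (@le_trans _ _ (1 * G ^+ w)).
    by rewrite mul1r.
  rewrite ler_pM ?exprn_ge0 //; last by rewrite lerXn2r ?nnegrE //; lra.
  by rewrite mulrC ler_pdivlMr ?exprn_gt0 // mul1r ler_wiXn2l ?(ltW x0) // ltnW.
rewrite big_split /= -mulr_sumr.
have -> : \sum_(J : {set I}) x ^+ #|J| = (1 + x) ^+ #|I|.
  transitivity (\prod_(i : I) (x + 1)); last by rewrite prodr_const addrC.
  rewrite bigA_distr; apply: eq_bigr => J _.
  by rewrite -big_mkcond /= prodr_const.
rewrite sumr_const -[q ^+ w *+ _]mulr_natl.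
have -> : #|{set I}|%:R = 2 ^+ #|I| :> R.
  by have := card_powerset [set: I]%SET; rewrite powersetT !cardsT => ->; rewrite natrX.
have hx : (1 + x) ^+ #|I| <= (8 / 7) ^+ w.
  apply: (@le_trans _ _ ((1 + x) ^+ (b * w))); first by rewrite ler_weXn2l //; lra.
  rewrite exprM lerXn2r ?nnegrE ?exprn_ge0 //; try lra.
  apply: (@le_trans _ _ (expR x ^+ b)).
    by rewrite lerXn2r ?nnegrE ?expR_ge0 ?expR_ge1Dx //; lra.
  rewrite -expRM_natr (_ : x * _ = 8^-1); last by rewrite /x; field; rewrite gt_eqF.
  by have := expR_le_inv1B R 8^-1 ltac:(lra); rewrite (_ : (1 - 8^-1)^-1 = 8 / 7) //; field.
have hA : (3 / 4) ^+ w / x ^+ (b ^ 2) * (1 + x) ^+ #|I| < 2^-1.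
  apply: (@le_lt_trans _ _ ((3 / 4) ^+ w / x ^+ (b ^ 2) * (8 / 7) ^+ w)).
    by rewrite ler_wpM2l ?divr_ge0 ?exprn_ge0 //; lra.
  rewrite mulrAC -exprMn (_ : 3 / 4 * (8 / 7) = 6 / 7); last by field.
  rewrite ltr_pdivrMr ?exprn_gt0 // [ltRHS]mulrC; exact: hw0.
by rewrite -/q in I2; lra.
Qed.

(** * From codes to unit vectors *)

Lemma inj_of_card_le (S T : finType) : (#|S| <= #|T|)%N ->
  exists f : S -> T, injective f.
Proof.
move=> le; exists (fun s => enum_val (widen_ord le (enum_rank s))).
by move=> s s' /enum_val_inj /(congr1 val) /= /ord_inj /enum_rank_inj.
Qed.

Lemma parity_code_transport (I V I' V' : finType) (w : nat) :
  (#|I'| <= #|I|)%N -> (#|V| <= #|V'|)%N -> parity_code I V w -> parity_code I' V' w.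
Proof.
move=> /inj_of_card_le[f f_inj] /inj_of_card_le[g g_inj] [A [Aw Aodd]].
exists (fun x => (g @: A (f x))%SET); split=> [x|J J0].
  by rewrite card_imset.
have J0' : (f @: J)%SET != finset.set0 by rewrite imset_eq0.
apply: (leq_trans (Aodd _ J0')); rewrite -(card_imset _ g_inj).
apply/subset_leq_card/fintype.subsetP => _ /imsetP[v + ->]; rewrite !finset.inE.
rewrite (_ : [set y in _ | _]%SET = (f @: [set x in J | g v \in (g @: A (f x))%SET])%SET).
  by rewrite card_imset.
apply/setP => y; rewrite finset.inE; apply/andP/imsetP.
  move=> [/imsetP[x xJ ->] vA]; exists x => //.
  by rewrite finset.inE xJ mem_imset.
by move=> [x + ->]; rewrite finset.inE !mem_imset // => /andP[-> ->].
Qed.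

(** A nonempty set of words of the disjoint union is nonempty in some copy, where
    its sum already has weight at least w. *)
Lemma parity_code_copies (I V : finType) (w K : nat) :
  parity_code I V w -> parity_code ('I_K * I)%type ('I_K * V)%type w.
Proof.
move=> [A [Aw Aodd]].
exists (fun kx => finset.setX [set kx.1]%SET (A kx.2)); split=> [kx|J /set0Pn[[k x] kxJ]].
  by rewrite cardsX cards1 mul1n.
pose Jk := [set x | (k, x) \in J]%SET.
have pk (X : Type) : injective (pair k : X -> 'I_K * X) by move=> a b [].
have Jk0 : Jk != finset.set0 by apply/set0Pn; exists x; rewrite finset.inE.
apply: (leq_trans (Aodd _ Jk0)); rewrite -(card_imset _ (pk V)).
apply/subset_leq_card/fintype.subsetP => _ /imsetP[v + ->]; rewrite !finset.inE.
rewrite -(card_imset _ (pk I)); congr (is_true (odd _)); apply: eq_card => -[k' y].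
rewrite !finset.inE /=; apply/imsetP/andP.
  by move=> [y' + [-> ->]]; rewrite !finset.inE => /andP[-> ->]; rewrite eqxx.
move=> [kyJ /andP[/eqP kk vA]]; exists y; last by rewrite kk.
by rewrite !finset.inE vA kk kyJ.
Qed.

(** Congruence modulo 2 of a real with a natural number; integrality of the real is
    part of the property. *)
Definition congr2 {R : realType} (z : R) (p : nat) : Prop :=
  exists k : int, z = (k * 2)%:~R + p%:R.

Lemma congr2_sum (R : realType) (T : finType) (z : T -> R) (p : T -> nat) :
  (forall t, congr2 (z t) (p t)) -> congr2 (\sum_t z t) (\sum_t p t).
Proof.
move=> /choice[k zk]; exists (\sum_t k t).
by rewrite mulr_suml rmorph_sum natr_sum -big_split; apply: eq_bigr.
Qed.

Lemma congr2_odd_ge1 (R : realType) (z : R) (p : nat) : congr2 z p -> odd p -> 1 <= `|z|.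
Proof.
move=> [k ->] op.
have -> : (k * 2)%:~R + p%:R = (k * 2 + p%:Z)%:~R :> R by rewrite intrD.
by rewrite -intr_norm ler1z -gtz0_ge1 normr_gt0; apply/eqP; lia.
Qed.

(** Let i be the largest layer with a nonzero coefficient.  After multiplication by
    2 ^ (i0 + i), lower layers contribute even integers, and the coefficients 1
    and -1 of layer i are odd: the parity of the coordinate c of the sum is that
    of the number of words of layer i containing c that are used. *)
Lemma layers_norm_ge1 (R : realType) (L D n i0 : nat)
    (A : 'I_L -> 'I_D -> {set 'I_n}) (eps : 'I_L * 'I_D -> R) :
  (forall (i : 'I_L) (J : {set 'I_D}), J != finset.set0 -> (4 ^ (i0 + i) <= #|odd_cover (A i) J|)%N) ->
  (forall t, eps t \in [:: -1; 0; 1]) -> (exists t, eps t != 0) ->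
  1 <= \sum_c (\sum_t eps t * (2^-1 ^+ (i0 + t.1) * (c \in A t.1 t.2)%:R)) ^+ 2.
Proof.
move=> Aodd eps01 [t0 et0].
have [t et tmax] := @arg_maxnP _ t0 (fun t => eps t != 0) (fun t => val t.1) et0.
case: t et tmax => [i x] /= et tmax.
pose J := [set y | eps (i, y) != 0]%SET.
have J0 : J != finset.set0 by apply/set0Pn; exists x; rewrite finset.inE.
pose S (c : 'I_n) : R := \sum_t eps t * (2^-1 ^+ (i0 + t.1) * (c \in A t.1 t.2)%:R).
have key c : c \in odd_cover (A i) J -> 4^-1 ^+ (i0 + i) <= S c ^+ 2.
  rewrite finset.inE => oc.
  have h : congr2 (2 ^+ (i0 + i) * S c)
      (\sum_(t : 'I_L * 'I_D) nat_of_bool ((t.1 == i) && (eps t != 0%R) && (c \in A t.1 t.2)))%N.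
    rewrite /S mulr_sumr; apply: congr2_sum => -[j y] /=.
    have [e0|e0] := eqVneq (eps (j, y)) 0.
      by rewrite e0 andbF mul0r mulr0; exists 0; rewrite mul0r addr0.
    have ji := tmax (j, y) e0; rewrite /= in ji.
    have e2 : 2 ^+ (i0 + i) = 2 ^+ (i - j) * 2 ^+ (i0 + j) :> R.
      by rewrite -exprD; congr (_ ^+ _); lia.
    rewrite e2 (_ : _ * _ = 2 ^+ (i - j) * eps (j, y) * (c \in A j y)%:R); last first.
      by rewrite exprVn; field; rewrite expf_neq0.
    rewrite andbT; case: (c \in A j y) => /=; last first.
      by rewrite mulr0 andbF; exists 0; rewrite mul0r addr0.
    rewrite andbT mulr1; have [jj|ne] := eqVneq j i.
      subst j; rewrite subnn expr0 mul1r /=; move: (eps01 (i, y)) e0; rewrite !inE.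
      move=> /or3P[]/eqP -> /eqP // _; first by exists (-1); rewrite intrM; ring.
      by exists 0; rewrite mul0r add0r.
    have -> : (i - j = (i - j).-1.+1)%N.
      by rewrite prednK // subn_gt0 ltn_neqAle; apply/andP; split.
    rewrite exprS.
    have pow k : 2 ^+ k = ((2 : int) ^+ k)%:~R :> R by rewrite rmorphXn.
    rewrite pow /=; move: (eps01 (j, y)) e0; rewrite !inE.
    move=> /or3P[]/eqP -> /eqP // _; [exists (- 2 ^+ (i - j).-1)|exists (2 ^+ (i - j).-1)];
      rewrite intrM ?rmorphN; ring.
  have p : odd (\sum_(t : 'I_L * 'I_D) nat_of_bool ((t.1 == i) && (eps t != 0%R) && (c \in A t.1 t.2)))%N.
    rewrite (_ : (\sum_t _)%N = #|[set y in J | c \in A i y]%SET|) //.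
    pose f j y := nat_of_bool ((j == i) && (eps (j, y) != 0) && (c \in A j y)).
    rewrite (eq_bigr (fun t => f t.1 t.2)) => [|[]//]; rewrite -(pair_bigA _ f) /f /=.
    rewrite (bigD1 i) //= [X in (_ + X)%N]big1 ?addn0; last first.
      by move=> j /negbTE ji; rewrite big1 // => y _; rewrite ji.
    rewrite -sum1_card [RHS]big_mkcond; apply: eq_bigr => y _.
    by rewrite eqxx !finset.inE /=; case: (_ && _).
  have := congr2_odd_ge1 _ _ _ h p; rewrite -(expr_ge1 (n := 2)) // -normrX ger0_norm ?sqr_ge0 //.
  rewrite exprMn exprVn -exprM mulnC exprM (_ : 2 ^+ 2 = 4) => [|]; last by rewrite expr2; lra.
  by rewrite -[X in _ -> X <= _]div1r ler_pdivrMr ?exprn_gt0 // mulrC.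
apply: (@le_trans _ _ (\sum_(c in odd_cover (A i) J) 4^-1 ^+ (i0 + i))).
  rewrite sumr_const -[leRHS]mulr_natl exprVn ler_pdivlMr ?exprn_gt0 // mul1r.
  by rewrite -natrX ler_nat; exact: Aodd.
rewrite big_mkcond; apply: ler_sum => c _.
by case: ifP => [/key//|_]; exact: sqr_ge0.
Qed.

(** Distinctness of the vectors comes for free: if u i = u j, then the difference
    of the two is a combination of norm 0. *)
Lemma not_always_balancing (R : realType) (L D n i0 m : nat) :
  (forall i : 'I_L, parity_code 'I_D 'I_n (4 ^ (i0 + i))) ->
  (m <= L * D)%N -> ~ always_balancing R n m.
Proof.
move=> /choice[A Ap] mLD bal.
have [h h_inj] : exists h : 'I_m -> 'I_L * 'I_D, injective h.
  by apply: inj_of_card_le; rewrite card_prod !card_ord.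
pose u (t : 'I_L * 'I_D) : 'rV[R]_n := \row_c (2^-1 ^+ (i0 + t.1) * (c \in A t.1 t.2)%:R).
have Aodd i := (Ap i).2.
have norm_ge1 (eps : 'I_m -> R) : (forall i, eps i \in [:: -1; 0; 1]) ->
    (exists i, eps i != 0) -> 1 <= \sum_c ((\sum_i eps i *: u (h i)) 0 c) ^+ 2.
  move=> e01 [i ei].
  pose eps' t : R := \sum_(i | h i == t) eps i.
  have eps'h j : eps' (h j) = eps j.
    rewrite /eps' (big_pred1 j) // => k; exact: inj_eq.
  have := layers_norm_ge1 R L D n i0 A eps' Aodd _ _.
  have -> : \sum_c (\sum_t eps' t * (2^-1 ^+ (i0 + t.1) * (c \in A t.1 t.2)%:R)) ^+ 2 =
      \sum_c ((\sum_i eps i *: u (h i)) 0 c) ^+ 2.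
    apply: eq_bigr => c _; congr (_ ^+ 2).
    rewrite summxE [RHS](partition_big h xpredT) //=; apply: eq_bigr => t _.
    rewrite /eps' mulr_suml; apply: eq_bigr => j /eqP <-.
    by rewrite !mxE.
  apply; last by exists (h i); rewrite eps'h.
  move=> t; have [[j <-]|nt] := pselect (exists j, h j = t); first by rewrite eps'h.
  by rewrite /eps' big1 ?inE ?eqxx ?orbT // => j /eqP ht; case: nt; exists j.
have [|i|eps [e01 e0]] := bal (u \o h).
- move=> i j /= uij; apply: contrapT => ij.
  have := norm_ge1 (fun k => (k == i)%:R - (k == j)%:R) _ _.
  have -> : \sum_k ((k == i)%:R - (k == j)%:R) *: u (h k) = 0.
    under eq_bigr do rewrite scalerBl.
    rewrite sumrB (bigD1 i) //= eqxx scale1r big1 ?addr0 => [|k /negbTE ->]; last by rewrite scale0r.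
    rewrite (bigD1 j) //= eqxx scale1r big1 ?addr0 => [|k /negbTE ->]; last by rewrite scale0r.
    by rewrite uij subrr.
  rewrite big1 => [|c _]; last by rewrite mxE expr0n.
  have ji : (i == j) = false by apply/eqP.
  move=> C; suff : (1 <= 0 :> R) by rewrite ler10.
  apply: C => [k|].
    rewrite !inE; have [->|_] := eqVneq k i; first by rewrite ji subr0 eqxx !orbT.
    by case: (k == j); rewrite sub0r ?oppr0 eqxx ?orbT.
  by exists i; rewrite eqxx ji subr0 oner_eq0.
- rewrite /enorm [X in Num.sqrt X](_ : _ = 1) ?sqrtr1 //.
  set t := h i; have At := (Ap t.1).1 t.2.
  transitivity (\sum_(c in A t.1 t.2) 4^-1 ^+ (i0 + t.1) : R).
    rewrite [RHS]big_mkcond; apply: eq_bigr => c _; rewrite mxE.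
    case: ifP => _ /=; last by rewrite mulr0 expr0n.
    by rewrite mulr1 -exprM mulnC exprM; congr (_ ^+ _); rewrite exprVn; congr (_^-1); ring.
  rewrite sumr_const At -[LHS]mulr_natl natrX -exprMn divff // expr1n //.
- by rewrite enorm_lt1 ltNge norm_ge1.
Qed.

(** * Asymptotics *)

(** A block size b = 2 ^ beta fixed once and for all gives rate 1 - (beta + 5) / b
    for all large w and all n of at least b ^ 2 w: of the redundancy, beta + 4
    comes from the random code (rounding included) and 1 from the coordinates
    left over by n / (w b) disjoint copies of it. *)
Lemma parity_code_dense (R : realType) (beta : nat) : (4 <= beta)%N ->
  exists w0, forall w n D, (w0 <= w)%N -> ((2 ^ beta) ^ 2 * w <= n)%N ->
    (D * 2 ^ beta <= n * (2 ^ beta - (beta + 5)))%N -> parity_code 'I_D 'I_n w.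
Proof.
move=> b4; set b := (2 ^ beta)%N.
have b9 : (beta + 5 <= b)%N.
  rewrite /b -(subnKC b4); elim: (beta - 4)%N => // k IH.
  by rewrite !addnS expnS; move: IH; set p := expn _ _; lia.
have b0 : (0 < b)%N by lia.
have [w0 hw0] := parity_code_base R b ltac:(lia).
exists (maxn w0 1) => w n D; rewrite geq_max => /andP[ww w1] bwn Dn.
pose t := (w * (b - beta - 3)).-1.
have t1 : t.+1 = (w * (b - beta - 3))%N by rewrite /t prednK // muln_gt0 w1 /=; lia.
have base : parity_code 'I_t ('I_w * 'I_b)%type w.
  apply: hw0; rewrite ?card_ord //.
    by apply: leq_trans (leqnSn _) _; rewrite t1 mulnC leq_mul2r; apply/orP; right; lia.
  have e : 8 * b%:R / 2 ^+ b = 2^-1 ^+ (b - beta - 3) :> R.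
    rewrite (_ : b%:R = 2 ^+ beta); last by rewrite /b natrX.
    rewrite (_ : 8 = 2 ^+ 3); last by ring.
    rewrite -exprD exprVn -[RHS]div1r.
    rewrite [X in _ / 2 ^+ X](_ : b = (3 + beta) + (b - beta - 3))%N; last by lia.
    by rewrite [X in _ / X]exprD; field; rewrite !expf_neq0.
  by rewrite e -exprM mulnC -t1 exprS mulrCA -exprMn divff // expr1n mulr1.
have := parity_code_copies _ _ _ (n %/ (w * b))%N base.
apply: parity_code_transport; rewrite !card_prod !card_ord; last exact: leq_trunc_div.
set K := (n %/ (w * b))%N.
have Kn : (n < K.+1 * (w * b))%N by rewrite ltn_ceil // muln_gt0 w1.
have Kt : (K * (w * (b - beta - 4)) <= K * t)%N.
  rewrite leq_mul2l -ltnS t1; apply/orP; right.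
  rewrite (_ : (b - beta - 3) = (b - beta - 4).+1)%N; last by lia.
  by rewrite mulnS; lia.
apply: leq_trans Kt.
have bb : (0 < b * b)%N by rewrite muln_gt0 b0.
rewrite -(leq_pmul2r bb).
have -> : (K * (w * (b - beta - 4)) * (b * b) = (K * (w * b)) * b * (b - beta - 4))%N by lia.
have h1 : (n * b <= K * (w * b) * b + n)%N.
  apply: leq_trans (_ : (K * (w * b) * b + b ^ 2 * w <= _)%N); last by rewrite leq_add2l.
  have -> : (K * (w * b) * b + b ^ 2 * w = K.+1 * (w * b) * b)%N by rewrite -mulnn mulSn; lia.
  by rewrite leq_mul2r ltnW ?orbT.
have h2 : (n * (b - 1) <= K * (w * b) * b)%N by rewrite mulnBr muln1 leq_subLR addnC.
apply: leq_trans (_ : (n * (b - 1) * (b - beta - 4) <= _)%N); last by rewrite leq_mul2r h2 orbT.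
apply: leq_trans (_ : (n * (b - (beta + 5)) * b <= _)%N); first by rewrite mulnA leq_mul2r Dn orbT.
rewrite -!mulnA leq_mul2l; apply/orP; right.
have [c ->] : exists c, (b = beta + 5 + c)%N by exists (b - (beta + 5))%N; lia.
rewrite (_ : (beta + 5 + c - (beta + 5) = c)%N); last by lia.
rewrite (_ : (beta + 5 + c - 1 = beta + 4 + c)%N); last by lia.
rewrite (_ : (beta + 5 + c - beta - 4 = c.+1)%N); last by lia.
nia.
Qed.

Lemma ltn_sigma (R : realType) (n m : nat) :
  (forall k, (k <= m)%N -> ~ always_balancing R n k) -> (m < sigma R n)%N.
Proof.
move=> h; rewrite /sigma; case: ex_minnP => k /asboolP bk _.
by rewrite ltnNge; apply/negP => /h.
Qed.

Lemma sigma_le (R : realType) (n m : nat) : always_balancing R n m -> (sigma R n <= m)%N.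
Proof.
by move=> h; rewrite /sigma; case: ex_minnP => k _; apply; apply/asboolP.
Qed.

(** One layer for each weight 4 ^ (i0 + i), i < L. *)
Lemma sigma_gt_layers (R : realType) (beta : nat) : (4 <= beta)%N ->
  exists i0, forall n L D, ((2 ^ beta) ^ 2 * 4 ^ (i0 + L) <= n)%N ->
    (D * 2 ^ beta <= n * (2 ^ beta - (beta + 5)))%N -> (L * D < sigma R n)%N.
Proof.
move=> b4; have [w0 hw0] := parity_code_dense R beta b4.
exists w0 => n L D Ln Dn; apply: ltn_sigma => k kLD.
apply: (not_always_balancing R L D n w0 k) => // i; apply: hw0 => //.
  by apply: leq_trans (leq_addr i w0) _; exact/ltnW/ltn_expl.
apply: leq_trans Ln; rewrite leq_mul2l leq_exp2l // leq_add2l.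
by rewrite ltnW ?orbT.
Qed.

Lemma near_ln_ge (R : realType) (Y : R) : \forall n \near \oo, Y <= ln (n%:R : R).
Proof.
exists (Num.truncn (expR Y)).+1 => // n /= hn.
have : expR Y <= n%:R.
  apply: ltW; have /andP[_ h] := truncn_itv (expR_ge0 Y).
  by apply: (lt_le_trans h); rewrite ler_nat.
have n0 : 0 < n%:R :> R by rewrite ltr0n; lia.
by move=> h; rewrite -[Y]expRK ler_ln ?posrE ?expR_gt0.
Qed.

Lemma near_nat_ge (R : realType) (Y : R) : \forall n \near \oo, Y <= (n%:R : R).
Proof.
near=> n; apply: (@le_trans _ _ (ln (n%:R : R))).
  by near: n; exact: near_ln_ge.
have [->|n0] := posnP n; first by rewrite ln0.
by apply/ltW/ln_sublinear; rewrite ltr0n.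
Unshelve. all: by end_near. Qed.

Lemma ln2_gt0 (R : realType) : 0 < ln 2 :> R.
Proof. by rewrite ln_gt0 // ltr1n. Qed.

Lemma exists_small_redundancy (R : realType) (e : R) : 0 < e ->
  exists beta, (4 <= beta)%N /\ (beta + 5)%:R < e * (2 ^ beta)%:R.
Proof.
move=> e0.
have [k0 hk] := geometric_lt R 2^-1 (e / 5) ltac:(lra) ltac:(lra).
exists (2 * maxn k0 2)%N; split; first by lia.
set k := maxn k0 2; have := hk k (leq_maxl _ _); rewrite exprVn => h.
have p : 0 < 2 ^+ k :> R by rewrite exprn_gt0.
have h1 : 5 < e * 2 ^+ k.
  have : (2 ^+ k)^-1 * 2 ^+ k < e / 5 * 2 ^+ k by rewrite ltr_pM2r.
  rewrite mulVf ?gt_eqF //; lra.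
have h2 : (2 * k + 5 <= 5 * 2 ^ k)%N by have := ltn_expl k (ltnSn 1); lia.
apply: (@le_lt_trans _ _ (5 * 2 ^+ k)).
  by rewrite -natrX -natrM ler_nat.
rewrite mulnC expnM natrX natrX expr2 mulrA ltr_pM2r //.
Qed.

(** The layers reach up to weight n / b ^ 2, so that L is (log n) / 2 up to an
    additive constant, while D is n up to a factor 1 - 2 eta. *)
Lemma sigma_lower (R : realType) (c : R) : c < 2^-1 ->
  \forall n \near \oo, c * n%:R * log2 n%:R < (sigma R n)%:R.
Proof.
move=> c12.
pose eta : R := Num.min (2^-1 - c) 2^-1 / 2.
have eta0 : 0 < eta by rewrite divr_gt0 // lt_min; apply/andP; split; lra.
have eta1 : 2 * eta <= 2^-1 - c by rewrite /eta mulrC divfK // ge_min lexx.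
have eta2 : 2 * eta <= 2^-1 by rewrite /eta mulrC divfK // ge_min lexx orbT.
have [beta [b4 hb]] := exists_small_redundancy R eta eta0.
have [i0 hi0] := sigma_gt_layers R beta b4.
set b := (2 ^ beta)%N in hb hi0.
have b0 : 0 < b%:R :> R by rewrite ltr0n expn_gt0.
pose C : R := (i0 + 1 + beta)%:R.
have l2 := ln2_gt0 R.
near=> n.
have n0 : (0 < n)%N by near: n; exists 1%N.
have nR : 0 < n%:R :> R by rewrite ltr0n.
have n1 : eta^-1 <= n%:R by near: n; exact: near_nat_ge.
have nln : ln 2 * (2 * C / eta) <= ln (n%:R : R) by near: n; exact: near_ln_ge.
have nbig : (b ^ 2 * 4 ^ i0)%:R <= n%:R :> R by near: n; exact: near_nat_ge.
rewrite ler_nat in nbig.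
set y : R := log2 n%:R.
have yC : 2 * C / eta <= y by rewrite /y /log2 ler_pdivlMr // mulrC.
pose D := (n * (b - (beta + 5)) %/ b)%N.
pose T := trunc_log 4 (n %/ b ^ 2).
pose L := (T - i0)%N.
have b20 : (0 < b ^ 2)%N by rewrite !expn_gt0.
have nb1 : (4 ^ i0 <= n %/ b ^ 2)%N by rewrite leq_divRL // mulnC.
have nb0 : (0 < n %/ b ^ 2)%N by apply: leq_trans nb1; rewrite expn_gt0.
have Ti : (i0 <= T)%N by rewrite /T; apply: trunc_log_max.
have hT : (4 ^ T <= n %/ b ^ 2 < 4 ^ T.+1)%N by exact: trunc_log_bounds.
have LD : (L * D < sigma R n)%N.
  apply: hi0; last exact: leq_trunc_div.
  by rewrite /L subnKC // mulnC -leq_divRL //; case/andP: hT.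
have Dge : n%:R * (1 - 2 * eta) <= D%:R.
  have : (n * (b - (beta + 5)) < D.+1 * b)%N by rewrite ltn_ceil // expn_gt0.
  rewrite -(ltr_nat R) !natrM => h.
  have h5 : (beta + 5 <= b)%N.
    have : (beta + 5)%:R <= b%:R :> R.
      by apply: (le_trans (ltW hb)); rewrite ger_pMl //; lra.
    by rewrite ler_nat.
  rewrite natrB // -natr1 in h.
  have h1 : n%:R * (b%:R - eta * b%:R) < (D%:R + 1) * b%:R.
    by apply: le_lt_trans h; rewrite ler_wpM2l // lerB // ltW.
  have h2 : n%:R * (1 - eta) < D%:R + 1.
    by rewrite -(ltr_pM2r b0); apply: le_lt_trans h1; rewrite le_eqVlt; apply/orP; left; apply/eqP; ring.
  have : 1 <= n%:R * eta by rewrite -ler_pdivrMr // mul1r.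
  lra.
have Lge : y / 2 - C <= L%:R.
  have h : n%:R <= b%:R ^+ 2 * 4 ^+ T.+1 :> R.
    rewrite -natrX -natrX -natrM ler_nat mulnC.
    have /andP[_] := hT; rewrite ltn_divLR //; exact: ltnW.
  have hb2 : b%:R = 2 ^+ beta :> R by rewrite /b natrX.
  have e4 : b%:R ^+ 2 * 4 ^+ T.+1 = 2 ^+ (2 * (beta + T.+1)) :> R.
    have -> : 4 = 2 ^+ 2 :> R by ring.
    by rewrite hb2 -!exprM -exprD mulnC mulnDr.
  rewrite e4 in h.
  have : ln n%:R <= ln (2 ^+ (2 * (beta + T.+1))) :> R.
    by rewrite ler_ln ?posrE ?exprn_gt0.
  rewrite lnXn // -[ln 2 *+ _]mulr_natl -ler_pdivrMr // -/(log2 _) -/y natrM => h3.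
  rewrite /L natrB // /C natrD natrD; rewrite [X in _ * X]natrD -[T.+1%:R]natr1 in h3; lra.
have yp : 0 <= y.
  apply: le_trans yC; rewrite divr_ge0 ?(ltW eta0) //; rewrite mulr_ge0 // /C //.
have C0 : 0 <= C by rewrite /C.
have hC : C <= y * eta / 2.
  have : 2 * C / eta * eta <= y * eta by rewrite ler_wpM2r // ltW.
  rewrite divfK ?gt_eqF //; lra.
apply: (@le_lt_trans _ _ (L * D)%:R); last by rewrite ltr_nat.
rewrite natrM.
have g0 : 0 <= 1 - 2 * eta by lra.
apply: (@le_trans _ _ ((y / 2 - C) * (n%:R * (1 - 2 * eta)))); last first.
  apply: ler_pM => //; last by rewrite mulr_ge0.
  have : y * eta <= y * 1 by rewrite ler_wpM2l //; lra.
  lra.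
rewrite (_ : c * n%:R * y = n%:R * (c * y)); last by ring.
rewrite (_ : (_ - C) * _ = n%:R * ((y / 2 - C) * (1 - 2 * eta))); last by ring.
rewrite ler_wpM2l ?(ltW nR) //.
have q1 : C * (1 - 2 * eta) <= y * eta / 2.
  by apply: le_trans hC; rewrite ler_piMr //; lra.
have q2 : y * (2 * eta) <= y * (2^-1 - c) by rewrite ler_wpM2l.
have q3 : 0 <= y * eta by rewrite mulr_ge0 // ltW.
lra.
Unshelve. all: by end_near. Qed.

(** With m close to c n log n, where 1/2 < c < c1, the bound of [unbalanced_le]
    would give c y <= y / 2 + (ln y) / 2 + O(1) for y = ln n. *)
Lemma sigma_upper (R : realType) (c1 : R) : 2^-1 < c1 ->
  \forall n \near \oo, (sigma R n)%:R < c1 * n%:R * log2 n%:R.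
Proof.
move=> c12.
pose c : R := (c1 + 2^-1) / 2.
have [ca cb] : 2^-1 < c /\ c < c1 by rewrite /c; split; lra.
have l2 := ln2_gt0 R.
pose a : R := c / ln 2.
have a0 : 0 < a by rewrite divr_gt0 //; lra.
(* The slope for which ln (a y) <= d (a y) - ln d spends half of the gap
   (c - 1/2) y, after the factor 1/2 coming from the square root of m. *)
pose d : R := (c - 2^-1) / a.
have d0 : 0 < d by rewrite divr_gt0 //; lra.
near=> n.
have n0 : (0 < n)%N by near: n; exists 1%N.
have nR : 0 < n%:R :> R by rewrite ltr0n.
have n1 : 1 <= n%:R :> R by rewrite ler1n.
have yY : (2 + ln 3 - ln d / 2) / ((c - 2^-1) / 2) <= ln (n%:R : R).
  by near: n; exact: near_ln_ge.
have ya : a^-1 <= ln (n%:R : R) by near: n; exact: near_ln_ge.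
set y : R := ln n%:R in yY ya.
have y0 : 0 < y by apply: lt_le_trans ya; rewrite invr_gt0.
rewrite ler_pdivrMr in yY; last by lra.
pose M : R := a * n%:R * y.
have ay1 : 1 <= a * y by rewrite mulrC -ler_pdivrMr // mul1r.
have M1 : 1 <= M.
  have -> : M = n%:R * (a * y) by rewrite /M; ring.
  by rewrite -[leLHS]mulr1 ler_pM.
have M0 : 0 < M by lra.
pose m := Num.truncn M.
have /andP[m1 m2] : m%:R <= M < m.+1%:R by exact/truncn_itv/ltW.
rewrite -natr1 in m2.
apply: (@le_lt_trans _ _ M); last first.
  have -> : M = c * n%:R * log2 n%:R.
    by rewrite /M /a /log2 -/y; field; rewrite gt_eqF.
  have ly : 0 < log2 (n%:R : R) by rewrite divr_gt0.
  by rewrite ltr_pM2r // ltr_pM2r.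
apply: le_trans (m1); rewrite ler_nat; apply: sigma_le => u _ u1.
apply: contrapT => nb.
have m0 : (0 < m)%N by rewrite truncn_gt0.
have := unbalanced_le R n m u n0 m0 u1 nb.
set s := Num.sqrt _.
have s0 : 0 <= s by exact: sqrtr_ge0.
have e1 : 0 < expR 1 :> R by exact: expR_gt0.
rewrite -ler_ln ?posrE ?exprn_gt0 ?mulr_gt0 //; try lra.
rewrite !lnXn ?mulr_gt0 //; try lra.
rewrite lnM ?posrE //; try lra.
rewrite expRK -[ln 2 *+ m]mulr_natl -[_ *+ n]mulr_natl.
have hs : ln (2 + s) <= ln 3 + ln M / 2.
  have rM : 1 <= Num.sqrt M by rewrite -[leLHS]sqrtr1 ler_sqrt ?(ltW M0).
  have -> : ln M = 2 * ln (Num.sqrt M).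
    have r0 : 0 < Num.sqrt M by lra.
    by rewrite -{1}(sqr_sqrtr (ltW M0)) (lnXn 2 r0) mulr_natl.
  rewrite mulrC mulKf // -lnM ?posrE //; try lra.
  have : s <= Num.sqrt M by rewrite ler_sqrt ?(ltW M0).
  by move=> ?; rewrite ler_ln ?posrE; lra.
have hM : ln M = y + ln (a * y).
  have -> : M = n%:R * (a * y) by rewrite /M; ring.
  by rewrite lnM ?posrE //; lra.
have hd : ln d + ln (a * y) < (c - 2^-1) * y.
  rewrite -lnM ?posrE //; last by lra.
  have -> : (c - 2^-1) * y = d * (a * y) by rewrite /d; field; rewrite gt_eqF.
  by apply: ln_sublinear; rewrite mulr_gt0 //; lra.
have l1 : ln 2 <= 1 :> R by have := @le_ln1Dx R 1 ltac:(lra); rewrite (_ : 1 + 1 = 2) //.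
have h1 : c * (n%:R * y) - n%:R < m%:R * ln 2.
  have : (M - 1) * ln 2 < m%:R * ln 2 by rewrite ltr_pM2r //; lra.
  have -> : (M - 1) * ln 2 = c * (n%:R * y) - ln 2.
    by rewrite /M /a; field; rewrite gt_eqF.
  lra.
apply/negP; rewrite -ltNge; apply: le_lt_trans h1.
have -> : c * (n%:R * y) - n%:R = n%:R * (c * y - 1) by ring.
rewrite ler_wpM2l ?(ltW nR) //.
lra.
Unshelve. all: by end_near. Qed.

Lemma equiv_of_bounds (R : realType) (f g : nat -> R) :
  (\forall n \near \oo, 0 <= g n) ->
  (forall e : R, 0 < e ->
    \forall n \near \oo, (1 - e) * g n <= f n <= (1 + e) * g n) ->
  f ~_\oo g.
Proof.
move=> g0 h; apply/eqaddoP => e e0; near=> n.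
have gn : 0 <= g n by near: n.
rewrite /= (ger0_norm gn) ler_norml.
have /andP[h1 h2] : (1 - e) * g n <= f n <= (1 + e) * g n by near: n; exact: h.
suff : - (e * g n) <= f n - g n <= e * g n by [].
move: (e : R) (f n) (g n) h1 h2 => e2 x y h1 h2; apply/andP; split; lra.
Unshelve. all: by end_near. Qed.

Theorem mainTheorem1 (R : realType) :
  (fun n : nat => (sigma R n)%:R : R) ~_\oo
    (fun n : nat => 2^-1 * n%:R * log2 (n%:R : R)) /\
  (forall c1 c2 : R, 2^-1 < c1 -> c2 < 2^-1 ->
    \forall n \near \oo,
      c2 * n%:R * log2 n%:R < (sigma R n)%:R < c1 * n%:R * log2 n%:R).
Proof.
have bounds (c1 c2 : R) : 2^-1 < c1 -> c2 < 2^-1 ->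
    \forall n \near \oo,
      c2 * n%:R * log2 n%:R < (sigma R n)%:R < c1 * n%:R * log2 n%:R.
  move=> c1h c2h; near=> n; apply/andP; split; near: n.
    exact: sigma_lower.
  exact: sigma_upper.
split; last exact: bounds.
apply: equiv_of_bounds => [|e e0].
  near=> n; have y0 : 0 <= ln (n%:R : R) by near: n; exact: near_ln_ge.
  have l0 : 0 <= log2 (n%:R : R) by rewrite divr_ge0 // ltW // ln2_gt0.
  by rewrite mulr_ge0 // mulr_ge0 // invr_ge0.
near=> n.
have /andP[h1 h2] : (1 - e) / 2 * n%:R * log2 n%:R < (sigma R n)%:R <
    (1 + e) / 2 * n%:R * log2 (n%:R : R).
  by near: n; apply: bounds; lra.
have E z : z * (2^-1 * n%:R * log2 (n%:R : R)) = z / 2 * n%:R * log2 (n%:R : R).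
  by ring.
by rewrite !E; apply/andP; split; apply: ltW.
Unshelve. all: by end_near. Qed.
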